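(* Let $0 < p < 2$ and suppose that $(\Omega, \mu)$ is a measure space. Let $D = [x_{j}(m_{j});y_{i}(n_{i})]_{s,t}$ be a non-degenerate signed $(s,t)$-simplex in $L_{p}(\Omega, \mu)$. Then the equality $$\sum_{1 \leq j_{1} < j_{2} \leq s} m_{j_{1}}m_{j_{2}} \| x_{j_{1}} - x_{j_{2}}\|_{p}^{p} + \sum_{1 \leq i_{1} < i_{2} \leq t} n_{i_{1}}n_{i_{2}} \| y_{i_{1}} - y_{i_{2}}\|_{p}^{p} = \sum_{j=1}^{s}\sum_{i=1}^{t} m_{j}n_{i} \| x_{j} - y_{i} \|_{p}^{p}$$ holds if and only if $D$ is virtually degenerate.
   Context: All measures are non-trivial and positive. $L_{p}(\Omega,\mu)$ is real or complex, carries the usual (quasi-)norm $\|f\|_p = (\int_\Omega |f|^p\,d\mu)^{1/p}$, and is assumed to be at least two-dimensional. A signed $(s,t)$-simplex in a set $X$ ($s,t>0$ integers) is a collection of (not necessarily distinct) points $x_{1},\ldots,x_{s},y_{1},\ldots,y_{t}\in X$ together with real numbers $m_{1},\ldots,m_{s},n_{1},\ldots,n_{t}$ satisfying $m_{1}+\cdots+m_{s}=n_{1}+\cdots+n_{t}$; it is denoted $D=[x_{j}(m_{j});y_{i}(n_{i})]_{s,t}$. Let $S(D)=\{x_1,\ldots,x_s\}\cup\{y_1,\ldots,y_t\}$ be the set of distinct points appearing in $D$. For $z\in S(D)$ put $\mathbf{m}(z)=\sum_{j:x_j=z}m_j$ and $\mathbf{n}(z)=\sum_{i:y_i=z}n_i$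 (empty sums are $0$). $D$ is degenerate if $\mathbf{m}(z)=\mathbf{n}(z)$ for all $z\in S(D)$. A non-degenerate signed $(s,t)$-simplex $D=[x_{j}(m_{j});y_{i}(n_{i})]_{s,t}$ in $L_p(\Omega,\mu)$ is virtually degenerate if for $\mu$-almost every $\omega\in\Omega$ the signed simplex $D(\omega)=[x_{j}(\omega)(m_{j});y_{i}(\omega)(n_{i})]_{s,t}$ in the scalar field is degenerate. *)

(* Defs.v *)
From HB Require Import structures.
From mathcomp Require Import all_boot all_order all_algebra.
From mathcomp Require Import complex.
From mathcomp Require Import all_classical all_reals all_analysis.
Import Order.TTheory GRing.Theory Num.Theory.
Import numFieldNormedType.Exports.

Set Implicit Arguments.
Unset Strict Implicit.
Unset Printing Implicit Defensive.

Local Open Scope classical_set_scope.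
Local Open Scope ring_scope.

Section signed_simplices.
Context (R : realType).

Record signed_simplex (X : Type) (s t : nat) := SignedSimplex {
  xpt : 'I_s -> X;
  ypt : 'I_t -> X;
  xwt : 'I_s -> R;
  ywt : 'I_t -> R;
  balanced : \sum_(j < s) xwt j = \sum_(i < t) ywt i }.

Definition map_simplex (X Y : Type) (s t : nat) (h : X -> Y)
    (D : signed_simplex X s t) : signed_simplex Y s t :=
  SignedSimplex (h \o xpt D) (h \o ypt D) (balanced D).

Context (X : eqType) (s t : nat) (D : signed_simplex X s t).

Definition simplex_points : seq X := undup (codom (xpt D) ++ codom (ypt D)).

Definition xmass (z : X) : R := \sum_(j < s | xpt D j == z) xwt D j.

Definition ymass (z : X) : R := \sum_(i < t | ypt D i == z) ywt D i.

Definition degenerate : Prop := {in simplex_points, forall z, xmass z = ymass z}.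

End signed_simplices.

Variant scalar_kind := RealScalars | ComplexScalars.

Section scalar_fields.
Context (R : realType).

Definition complex_coords (z : R[i]) : R * R := (complex.Re z, complex.Im z).

Definition scalar_numField (k : scalar_kind) : numFieldType :=
  match k with
  | RealScalars => R
  | ComplexScalars => R[i]
  end.

Definition scalar_field (k : scalar_kind) : Type := scalar_numField k.

HB.instance Definition _ (k : scalar_kind) :=
  Num.NumField.copy (scalar_field k) (scalar_numField k).

HB.instance Definition _ (k : scalar_kind) := isPointed.Build (scalar_field k) 0.

Definition modulus (k : scalar_kind) : scalar_field k -> R :=
  match k with
  | RealScalars => fun x : R => `|x|
  | ComplexScalars => fun z : R[i] => ComplexField.Normc.normc z
  end.

(* The Borel sets; those of the complex numbers are pulled back from R * R, so
   that a function is measurable iff its real and imaginary parts are. *)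
Definition scalar_borel (k : scalar_kind) : set (set (scalar_field k)) :=
  match k with
  | RealScalars => (measurable : set (set R))
  | ComplexScalars => preimage_set_system setT complex_coords measurable
  end.

Arguments scalar_borel : clear implicits.

Let scalar_borel_sigma k : sigma_algebra setT (scalar_borel k).
Proof.
case: k; first exact: sigma_algebra_measurable.
exact/sigma_algebra_preimage/sigma_algebra_measurable.
Qed.

Let scalar_borel0 k : scalar_borel k set0.
Proof. by case: (scalar_borel_sigma k). Qed.

Let scalar_borelC k (A : set (scalar_field k)) :
  scalar_borel k A -> scalar_borel k (~` A).
Proof. by rewrite -setTD; case: (scalar_borel_sigma k) => _ + _; apply. Qed.

Let scalar_borelU k (F : (set (scalar_field k))^nat) :
  (forall n, scalar_borel k (F n)) -> scalar_borel k (\bigcup_n F n).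
Proof. by case: (scalar_borel_sigma k) => _ _; apply. Qed.

HB.instance Definition _ (k : scalar_kind) :=
  @isMeasurable.Build default_measure_display (scalar_field k) (scalar_borel k)
    (@scalar_borel0 k) (@scalar_borelC k) (@scalar_borelU k).

End scalar_fields.

Section Lp_spaces.
Context (R : realType) (d : measure_display) (Omega : measurableType d).
Variables (mu : {measure set Omega -> \bar R}) (p : R) (k : scalar_kind).

Definition eLp_norm (f : Omega -> scalar_field R k) : \bar R :=
  ('N[mu]_p%:E [EFin \o @modulus R k \o f])%E.

Definition Lp_norm (f : Omega -> scalar_field R k) : R := fine (eLp_norm f).

(* LspaceType is real-valued and needs 1 <= p. Points of L_p are classes modulo
   almost everywhere equality; such a class is coerced to a function through its
   canonical representative. *)
Definition Lp : Type :=
  {f : {mfun_ mu, Omega >-> scalar_field R k} | (eLp_norm f < +oo)%E}.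

HB.instance Definition _ := Choice.on Lp.

Definition Lp_fun (f : Lp) : Omega -> scalar_field R k := \val f.
Coercion Lp_fun : Lp >-> Funclass.

Definition Lp_eval (w : Omega) (f : Lp) : scalar_field R k := f w.

Definition at_least_two_dimensional : Prop :=
  exists f g : Lp, forall a b : scalar_field R k,
    {ae mu, forall w, a * f w + b * g w = 0} -> a = 0 /\ b = 0.

Definition virtually_degenerate (s t : nat)
    (D : signed_simplex R Lp s t) : Prop :=
  ~ degenerate D /\ {ae mu, forall w, degenerate (map_simplex (Lp_eval w) D)}.

End Lp_spaces.

(* Main.v *)
(* Over the index set ['I_s + 'I_t], give x_j the weight c = m_j and y_i the
   weight c = - n_i. The difference of the two sides of the equality is
   half the integral over Omega of the pointwise form sum c_a c_b |z_a - z_b|^p, so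
   it suffices that this form is nonpositive and vanishes only at degenerate
   configurations. As 0 < p/2 < 1, |z|^p is proportional to the integral of
   (1 - e^(- t |z|^2)) t^(- 1 - p/2) dt over t > 0; as the weights sum to 0, the
   form is minus a positive mixture of the Gaussian forms
   sum c_a c_b e^(- t |z_a - z_b|^2). These are nonnegative (expand e^(2 t <u, v>))
   and tend, as t grows, to the sum of the squares of the total weights of
   the distinct points, which is positive unless the configuration is degenerate. *)
Require Import Defs.
From mathcomp Require Import all_boot all_order all_algebra.
From mathcomp Require Import all_classical all_reals all_analysis.
From mathcomp Require Import complex measurable_realfun ring lra.
Import Order.TTheory GRing.Theory Num.Theory.
Import numFieldNormedType.Exports.

Local Open Scope classical_set_scope.
Local Open Scope ring_scope.

(** * Grouping a weighted finite family by its distinct points *)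

Section fiber_masses.
Context {R : realType} {I : finType} {T : eqType}.
Variables (z : I -> T) (c : I -> R).

Definition fiber_mass (t : T) : R := \sum_(a | z a == t) c a.

(** Dividing by the size of the fiber lets a sum over indices stand for a sum over the distinct
    values of [z]. The identity follows by averaging each term over its fiber and exchanging the
    sums. *)
Lemma sum_fiber_mass (h : T -> R) :
  \sum_a c a * h (z a) =
  \sum_a fiber_mass (z a) * h (z a) / #|[pred b | z b == z a]|%:R.
Proof.
have card_neq0 a : #|[pred b | z b == z a]|%:R != 0 :> R.
  by rewrite pnatr_eq0 -lt0n; apply/card_gt0P; exists a; rewrite inE.
transitivity (\sum_a \sum_(b | z b == z a)
    c b * h (z b) / #|[pred b' | z b' == z b]|%:R).
  rewrite (exchange_big_dep predT)//=; apply: eq_bigr => a _.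
  rewrite (eq_bigl [pred b | z b == z a]) => [|b]; last by rewrite inE eq_sym.
  by rewrite sumr_const -[RHS]mulr_natr divfK.
apply: eq_bigr => a _; rewrite /fiber_mass mulrAC -mulrA mulr_suml.
by apply: eq_bigr => b /eqP <-; rewrite mulrA mulrAC.
Qed.

Lemma sum_fiber_mass0 (h : T -> R) :
  (forall a, fiber_mass (z a) = 0) -> \sum_a c a * h (z a) = 0.
Proof.
by move=> m0; rewrite sum_fiber_mass big1// => a _; rewrite m0 !mul0r.
Qed.

(** Grouped by distinct values of [z], the double sum is a sum of squares of fiber masses, and the
    square at [z a0] is positive. *)
Lemma sum_same_fiber_gt0 a0 : fiber_mass (z a0) != 0 ->
  0 < \sum_a \sum_b c a * c b * (z a == z b)%:R.
Proof.
move=> ma0; have -> : \sum_a \sum_b c a * c b * (z a == z b)%:R =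
    \sum_a c a * fiber_mass (z a).
  apply: eq_bigr => a _; rewrite /fiber_mass mulr_sumr [RHS]big_mkcond/=.
  by apply: eq_bigr => b _; rewrite eq_sym; case: eqP; rewrite ?mulr1 ?mulr0.
have term_ge0 a : 0 <= fiber_mass (z a) * fiber_mass (z a) /
    #|[pred b | z b == z a]|%:R.
  by rewrite divr_ge0// -expr2 sqr_ge0.
rewrite (sum_fiber_mass fiber_mass) (bigD1 a0)//= ltr_pwDl ?sumr_ge0//.
rewrite divr_gt0//; first by rewrite -expr2 exprn_even_gt0.
by rewrite ltr0n; apply/card_gt0P; exists a0; rewrite inE.
Qed.

End fiber_masses.

(** * Squared Euclidean distance in the plane *)

Section sqdist.
Context {R : realType}.
Implicit Types u v : R * R.

Definition sqdist u v : R := (u.1 - v.1) ^+ 2 + (u.2 - v.2) ^+ 2.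

Lemma sqdistxx u : sqdist u u = 0.
Proof. by rewrite /sqdist !subrr expr0n addr0. Qed.

Lemma sqdistC u v : sqdist u v = sqdist v u.
Proof. by rewrite /sqdist -sqrrN opprB -[X in _ + X]sqrrN opprB. Qed.

Lemma sqdist_ge0 u v : 0 <= sqdist u v.
Proof. by rewrite addr_ge0 ?sqr_ge0. Qed.

Lemma sqdist_eq0 u v : (sqdist u v == 0) = (u == v).
Proof. by rewrite paddr_eq0 ?sqr_ge0// !sqrf_eq0 !subr_eq0. Qed.

(** The right side minus the left side is the squared norm of u - 2 v + w. *)
Lemma sqdist_triangle u v w : sqdist u w <= 2 * (sqdist u v + sqdist v w).
Proof.
rewrite /sqdist -subr_ge0; set lhs := (X in 0 <= X).
have -> : lhs = (u.1 - 2 * v.1 + w.1) ^+ 2 + (u.2 - 2 * v.2 + w.2) ^+ 2.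
  by rewrite /lhs; ring.
by rewrite addr_ge0 ?sqr_ge0.
Qed.

Lemma measurable_sqdist d (T : measurableType d) (f g : T -> R * R) :
  measurable_fun setT f -> measurable_fun setT g ->
  measurable_fun setT (fun t => sqdist (f t) (g t)).
Proof.
move=> mf mg; apply: measurable_funD; apply: measurable_funX;
  by apply: measurable_funB; apply: measurableT_comp.
Qed.

End sqdist.

(** * Positivity of Gaussian kernels *)

Section gaussian_kernel.
Context {R : realType} {I : finType}.
Implicit Types (K : I -> I -> R) (c x y : I -> R).

Definition quadratic_form K c : R := \sum_a \sum_b c a * c b * K a b.

Definition psd K : Prop := forall c, 0 <= quadratic_form K c.

Lemma psd_cst1 : psd (fun _ _ => 1).
Proof.
move=> c; rewrite /quadratic_form.
have -> : \sum_a \sum_b c a * c b * 1 = (\sum_a c a) ^+ 2.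
  rewrite expr2 mulr_suml; apply: eq_bigr => a _; rewrite mulr_sumr.
  by apply: eq_bigr => b _; rewrite mulr1.
exact: sqr_ge0.
Qed.

Lemma cvg_quadratic_form {T : Type} (F : set_system T) {FF : Filter F}
    (K : T -> I -> I -> R) (L : I -> I -> R) c :
  (forall a b, K t a b @[t --> F] --> L a b) ->
  quadratic_form (K t) c @[t --> F] --> quadratic_form L c.
Proof.
move=> KL; apply: cvg_big => [|a _]; first exact: add_continuous.
apply: cvg_big => [|b _]; first exact: add_continuous.
by apply: cvgM; [exact: cvg_cst|exact: KL].
Qed.

(** In the exponential series, the term of degree k contributes g^k / k! times the form of [K] at
    the weights c_a x_a^k. All partial sums are thus nonnegative, and so is their limit. *)
Lemma psd_mul_expR K x g : 0 <= g -> psd K ->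
  psd (fun a b => expR (g * (x a * x b)) * K a b).
Proof.
move=> g0 psdK c.
have cvgK : quadratic_form
    (fun a b => series (exp_coeff (g * (x a * x b))) n * K a b) c @[n --> \oo]
    --> quadratic_form (fun a b => expR (g * (x a * x b)) * K a b) c.
  apply: cvg_quadratic_form => a b; apply: cvgM.
    exact: is_cvg_series_exp_coeff.
  exact: cvg_cst.
rewrite -(cvg_lim _ cvgK)//; apply: limr_ge; first exact: cvgP cvgK.
apply: nearW => n.
have -> : quadratic_form
    (fun a b => series (exp_coeff (g * (x a * x b))) n * K a b) c =
    \sum_(0 <= k < n) g ^+ k / k`!%:R *
      quadratic_form K (fun a => c a * x a ^+ k).
  rewrite /quadratic_form.
  under [RHS]eq_bigr do rewrite mulr_sumr.
  rewrite [RHS]exchange_big/=; apply: eq_bigr => a _.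
  under [RHS]eq_bigr do rewrite mulr_sumr.
  rewrite [RHS]exchange_big/=; apply: eq_bigr => b _.
  rewrite /series/= mulr_suml mulr_sumr; apply: eq_bigr => k _.
  by rewrite /exp_coeff/= !exprMn; ring.
by apply: sumr_ge0 => k _; rewrite mulr_ge0 ?divr_ge0 ?exprn_ge0 ?psdK.
Qed.

(** Expand - t |u - v|^2 = - t |u|^2 - t |v|^2 + 2 t <u, v>. The factors from |u|^2 and |v|^2 are
    absorbed into the weights; the one from <u, v> is built from the constant kernel by
    [psd_mul_expR], applied once per coordinate. *)
Lemma psd_gaussian (z : I -> R * R) t : 0 <= t ->
  psd (fun a b => expR (- (t * sqdist (z a) (z b)))).
Proof.
move=> t0 c.
have t20 : 0 <= 2 * t by rewrite mulr_ge0.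
have := psd_mul_expR _ (fst \o z) _ t20 (psd_mul_expR _ (snd \o z) _ t20 psd_cst1)
  (fun a => c a * expR (- (t * ((z a).1 ^+ 2 + (z a).2 ^+ 2)))).
congr (_ <= _); apply: eq_bigr => a _; apply: eq_bigr => b _.
rewrite mulr1 /=; set Ea := expR (- _); set Eb := expR (- _).
set ex := expR _; set ey := expR _; set e := expR _.
suff -> : e = Ea * Eb * (ex * ey) by ring.
by rewrite -!expRD; congr expR; rewrite /sqdist; ring.
Qed.

(** As t grows, the kernel tends to the indicator of z_a = z_b, whose form is positive by
    [sum_same_fiber_gt0]. *)
Lemma quadratic_form_gaussian_gt0 (z : I -> R * R) c a0 :
  fiber_mass z c (z a0) != 0 ->
  \forall t \near +oo, 0 < quadratic_form
    (fun a b => expR (- (t * sqdist (z a) (z b)))) c.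
Proof.
move=> /sum_same_fiber_gt0; apply: cvgr_gt.
apply: cvg_quadratic_form => a b; have [->|zN] := eqVneq (z a) (z b).
  under eq_fun do rewrite sqdistxx mulr0 oppr0 expR0.
  exact: cvg_cst.
apply: (@cvg_comp _ _ _ (fun t => t * sqdist (z a) (z b)) (fun v => expR (- v))
  _ (pinfty_nbhs R)); last exact: cvgr_expR.
apply: gt0_cvgMly; last exact: cvg_id.
by rewrite lt_neqAle eq_sym sqdist_eq0 zN sqdist_ge0.
Qed.

End gaussian_kernel.

(** * Powers as mixtures of the functions 1 - e^(- t r) *)

Section power_integral.
Context {R : realType}.
Variable alpha : R.
Local Notation mu := (@lebesgue_measure R).

(* The substitution [t = e^u] in [(1 - e^(- r t)) t^(- 1 - alpha) dt]. *)
Definition bernstein_integrand (r u : R) : R :=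
  (1 - expR (- (expR u * r))) * expR (- (alpha * u)).

(** For 0 < alpha < 1 this is Gamma(1 - alpha) / alpha, the factor between r^alpha and its integral
    representation. *)
Definition bernstein_integral : R := \int[mu]_u bernstein_integrand 1 u.

Lemma continuous_bernstein_integrand r : continuous (bernstein_integrand r).
Proof.
move=> u; apply: cvgM.
  apply: cvgB; first exact: cvg_cst.
  apply: continuous_comp; last exact: continuous_expR.
  by apply: cvgN; apply: cvgM; [exact: continuous_expR|exact: cvg_cst].
apply: continuous_comp; last exact: continuous_expR.
by apply: cvgN; apply: cvgM; [exact: cvg_cst|exact: cvg_id].
Qed.

Lemma measurable_bernstein_integrand r :
  measurable_fun [set: R] (bernstein_integrand r).
Proof.
apply: continuous_measurable_fun; exact: continuous_bernstein_integrand.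
Qed.

Lemma bernstein_integrand_ge0 r u : 0 <= r -> 0 <= bernstein_integrand r u.
Proof.
move=> r0; rewrite mulr_ge0 ?expR_ge0// subr_ge0 expR_le1 oppr_le0.
by rewrite mulr_ge0 ?expR_ge0.
Qed.

Lemma bernstein_integrand1_gt0 u : 0 < bernstein_integrand 1 u.
Proof.
rewrite mulr_gt0 ?expR_gt0// subr_gt0 expR_lt1 oppr_lt0.
by rewrite mulr1 expR_gt0.
Qed.

(** In the variable u = ln t, the dilation of t by r becomes the translation of u by ln r. *)
Lemma bernstein_integrand_scale r u : 0 < r ->
  bernstein_integrand r u = r `^ alpha * bernstein_integrand 1 (u + ln r).
Proof.
move=> r0; rewrite /bernstein_integrand expRD lnK ?posrE// mulr1 mulrCA.
by congr (_ * _); rewrite /powR gt_eqF// -expRD; congr expR; ring.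
Qed.

Lemma integral_translation (f : R -> R) v : continuous f ->
  (forall x, 0 <= f x) ->
  (\int[mu]_x (f (x + v))%:E = \int[mu]_x (f x)%:E)%E.
Proof.
move=> cf f0; have dF (x : R) : is_derive x 1 (shift v : R -> R) 1.
  exact: is_derive_shift.
have dF1 : derive1 (shift v : R -> R) = cst 1.
  by apply/funext => x; rewrite derive1E derive_val.
rewrite (@increasing_ge0_integration_by_substitutionT _ (shift v) f)//.
- by apply: eq_integral => x _; rewrite dF1 /= mulr1.
- by move=> x y xy; rewrite ltrD2r.
- by rewrite dF1 => x; exact: cvg_cst.
- by rewrite dF1; exact: is_cvg_cst.
- by rewrite dF1; exact: is_cvg_cst.
- exact: cvg_addrr_Ny.
- exact: cvg_addrr.
Qed.

Hypotheses (alpha_gt0 : 0 < alpha) (alpha_lt1 : alpha < 1).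

(** For u >= 0, bounding the first factor by 1 leaves e^(- alpha u). For u < 0, the bound 1 - e^(-
    x) <= x at x = e^u leaves e^((1 - alpha) u). Both are multiples of exponential densities, the
    second one reflected. *)
Lemma bernstein_integrand1_le u : bernstein_integrand 1 u <=
  alpha^-1 * exponential_pdf alpha u +
  (1 - alpha)^-1 * exponential_pdf (1 - alpha) (- u).
Proof.
have alpha1_gt0 : 0 < 1 - alpha by rewrite subr_gt0.
have pdf0 a v : 0 < a -> 0 <= a^-1 * exponential_pdf a v.
  by move=> a0; rewrite mulr_ge0 ?invr_ge0 ?exponential_pdf_ge0// ltW.
have pdfE a v : 0 < a -> 0 <= v -> a^-1 * exponential_pdf a v = expR (- (a * v)).
  by move=> a0 v0; rewrite exponential_pdfE//= mulKf ?gt_eqF// mulNr.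
rewrite /bernstein_integrand mulr1; have [u0|/ltW u0] := leP 0 u.
  apply: ler_wpDr; first exact: pdf0.
  by rewrite pdfE// ger_pMl ?expR_gt0// gerBl expR_ge0.
apply: ler_wpDl; first exact: pdf0.
rewrite pdfE ?oppr_ge0// (_ : - (_ * - u) = u + - (alpha * u)); last by ring.
rewrite expRD ler_wpM2r ?expR_ge0//.
by have := expR_ge1Dx (- expR u); lra.
Qed.

(** Reflection preserves Lebesgue measure, so the integral is again that of the density. *)
Lemma integrable_exponential_pdfN a : 0 < a ->
  mu.-integrable setT (EFin \o (fun u : R => exponential_pdf a (- u))).
Proof.
move=> a0; have mpdf := @measurable_exponential_pdf R a.
have mpdfN : measurable_fun setT (fun u : R => exponential_pdf a (- u)).
  exact: measurableT_comp.
apply/integrableP; split; first exact/measurable_EFinP.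
under eq_integral do rewrite /= ger0_norm ?exponential_pdf_ge0 ?ltW//.
have mN : measurable_fun [set: measurableTypeR R]
    (-%R : measurableTypeR R -> measurableTypeR R).
  exact: measurable_funN.
have <- : (\int[pushforward mu (-%R : _ -> measurableTypeR R)]_u
    (exponential_pdf a u)%:E = \int[mu]_u (exponential_pdf a (- u))%:E)%E.
  rewrite ge0_integral_pushforward//.
  - exact/measurable_EFinP.
  - by move=> u _; rewrite lee_fin exponential_pdf_ge0// ltW.
rewrite (eq_measure_integral mu) => [|A mA _].
  by rewrite integral_exponential_pdf// ltry.
exact: lebesgue_measureN.
Qed.

Lemma integrable_bernstein_integrand1 :
  mu.-integrable setT (EFin \o bernstein_integrand 1).
Proof.
have alpha1_gt0 : 0 < 1 - alpha by rewrite subr_gt0.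
pose bound (u : R) := alpha^-1 * exponential_pdf alpha u +
  (1 - alpha)^-1 * exponential_pdf (1 - alpha) (- u).
apply: (@le_integrable _ _ R mu setT measurableT _ (EFin \o bound)).
- by apply/measurable_EFinP; exact: measurable_bernstein_integrand.
- move=> u _ /=; rewrite lee_fin ger0_norm ?bernstein_integrand_ge0//.
  exact: le_trans (bernstein_integrand1_le u) (ler_norm _).
- have -> : EFin \o bound =
    ((fun u => (alpha^-1)%:E * (exponential_pdf alpha u)%:E) \+
     (fun u => ((1 - alpha)^-1)%:E * (exponential_pdf (1 - alpha) (- u))%:E))%E.
    by apply/funext => u /=; rewrite EFinD !EFinM.
  apply: integrableD => //.
    by apply: integrableZl => //; exact: integrable_exponential_pdf.
  by apply: integrableZl => //; exact: integrable_exponential_pdfN.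
Qed.

(** Scaling extracts r^alpha and leaves a translate, which has the same integral. The case r = 0,
    where ln r is meaningless, is separate: both sides vanish, since alpha is nonzero. *)
Lemma integral_bernstein_integrand r : 0 <= r ->
  (\int[mu]_u (bernstein_integrand r u)%:E =
   (r `^ alpha * bernstein_integral)%:E)%E.
Proof.
rewrite le_eqVlt => /predU1P[<-|r0].
  rewrite powR0 ?gt_eqF// mul0r integral0_eq// => u _.
  by rewrite /bernstein_integrand mulr0 oppr0 expR0 subrr mul0r.
under eq_integral do rewrite bernstein_integrand_scale// EFinM.
rewrite ge0_integralZl//.
- rewrite integral_translation => [|//|].
  + rewrite EFinM /bernstein_integral /Rintegral fineK//.
    exact: integrable_fin_num integrable_bernstein_integrand1.
  + exact: continuous_bernstein_integrand.
  + by move=> x; exact: bernstein_integrand_ge0.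
- apply/measurable_EFinP/(measurableT_comp (measurable_bernstein_integrand 1)).
  exact: measurable_funD.
- by move=> u _; rewrite lee_fin bernstein_integrand_ge0.
- by rewrite lee_fin powR_ge0.
Qed.

Lemma integrable_bernstein_integrand r : 0 <= r ->
  mu.-integrable setT (EFin \o bernstein_integrand r).
Proof.
move=> r0; apply/integrableP; split.
  by apply/measurable_EFinP; exact: measurable_bernstein_integrand.
under eq_integral do rewrite /= ger0_norm ?bernstein_integrand_ge0//.
by rewrite integral_bernstein_integrand// ltry.
Qed.

End power_integral.

(** * Exchange of finite quadratic forms with integrals *)

Section integral_quadratic_form.
Context {R : realType} {d : measure_display} {T : measurableType d}.
Context {I : finType} {mu : {measure set T -> \bar R}}.
Variables (K : I -> I -> T -> R) (c : I -> R).
Hypothesis intK : forall a b, mu.-integrable setT (EFin \o K a b).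

Let term a b t := ((c a * c b)%:E * (K a b t)%:E)%E.

Let int_term a b : mu.-integrable setT (term a b).
Proof. exact: (integrableZl measurableT (c a * c b) (intK a b)). Qed.

Let quadratic_formE :
  EFin \o (fun t => quadratic_form (fun a b => K a b t) c) =
  (fun t => \sum_a \sum_b term a b t)%E.
Proof.
apply/funext => t /=; rewrite -sumEFin; apply: eq_bigr => a _.
by rewrite -sumEFin; apply: eq_bigr => b _; rewrite EFinM.
Qed.

Lemma integrable_quadratic_form :
  mu.-integrable setT (EFin \o (fun t => quadratic_form (fun a b => K a b t) c)).
Proof.
by rewrite quadratic_formE; do 2 (apply: integrable_sum => // ? _).
Qed.

Lemma integral_quadratic_form :
  (\int[mu]_t (quadratic_form (fun a b => K a b t) c)%:E =
   (quadratic_form (fun a b => \int[mu]_t K a b t) c)%:E)%E.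
Proof.
have -> := congr1 (fun f => \int[mu]_t f t)%E quadratic_formE.
rewrite integral_sum//; last by move=> a; exact: integrable_sum.
rewrite -sumEFin; apply: eq_bigr => a _; rewrite integral_sum// -sumEFin.
apply: eq_bigr => b _; rewrite (integralZl measurableT (intK a b)).
by rewrite [RHS]EFinM /Rintegral fineK//; exact: integrable_fin_num (intK a b).
Qed.

End integral_quadratic_form.

(** A zero integral would make [f] vanish off a null set, yet [f] is positive on an interval []M, M
    + 1]] of measure 1. *)
Lemma lebesgue_integral_gt0 {R : realType} (f : R -> R) :
  measurable_fun setT f -> (forall x, 0 <= f x) ->
  (\forall x \near +oo, 0 < f x) -> (0 < \int[lebesgue_measure]_x (f x)%:E)%E.
Proof.
move=> mf f0 [M [_ fM]]; rewrite lt_neqAle integral_ge0 ?andbT; last first.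
  by move=> x _; rewrite lee_fin.
apply/eqP => /esym int0.
have /ae_eq_integral_abs : (\int[lebesgue_measure]_x `|(f x)%:E| = 0)%E.
  by under eq_integral do rewrite gee0_abs ?lee_fin//.
case/(_ measurableT); first exact/measurable_EFinP.
move=> N [mN N0 fN].
suff : (lebesgue_measure `]M, (M + 1)%R] <= (0 : \bar R))%E.
  rewrite lebesgue_measure_itv/= lte_fin ltrDl ltr01 -EFinD addrAC subrr.
  by rewrite add0r lee_fin ler10.
rewrite -N0; apply: le_measure; rewrite ?inE//= => x /=.
rewrite in_itv/= => /andP[Mx _]; apply: fN => /= /(_ I) [fx0].
by have := fM x Mx; rewrite fx0 ltxx.
Qed.

(** * Strict negativity of the form with kernel |u - v|^(2 alpha) *)

Section strict_negative_type.
Context {R : realType} {I : finType}.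
Variables (z : I -> R * R) (c : I -> R) (alpha : R).
Hypotheses (alpha_gt0 : 0 < alpha) (alpha_lt1 : alpha < 1).
Local Notation form :=
  (quadratic_form (fun a b => sqdist (z a) (z b) `^ alpha) c).

(** The inner sum depends on [a] only through the point [z a], so [sum_fiber_mass0] applies to
    it. *)
Lemma sqdist_powR_form_eq0 :
  (forall a, fiber_mass z c (z a) = 0) -> form = 0.
Proof.
move=> m0.
rewrite -(sum_fiber_mass0 z c (fun u => \sum_b c b * sqdist u (z b) `^ alpha) m0).
by apply: eq_bigr => a _; rewrite mulr_sumr; apply: eq_bigr => b _; rewrite mulrA.
Qed.

(* Since the weights sum to [0], the constant [1] in [1 - e^(- t r)] contributes
   nothing, and minus the form is a positive mixture of Gaussian forms. *)
Lemma sqdist_powR_form_lt0 a0 : \sum_a c a = 0 ->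
  fiber_mass z c (z a0) != 0 -> form < 0.
Proof.
move=> c0 ma0.
(* The last factor is the weight t^(- 1 - alpha) dt in the variable u = ln t. *)
pose gauss u := quadratic_form (fun a b => expR (- (expR u * sqdist (z a) (z b)))) c
  * expR (- (alpha * u)).
have gauss_ge0 u : 0 <= gauss u.
  by rewrite mulr_ge0 ?expR_ge0//; apply: psd_gaussian; rewrite expR_ge0.
have gaussE u : gauss u =
    - quadratic_form (fun a b => bernstein_integrand alpha (sqdist (z a) (z b)) u) c.
  have -> : quadratic_form
      (fun a b => bernstein_integrand alpha (sqdist (z a) (z b)) u) c =
      (\sum_a c a) ^+ 2 * expR (- (alpha * u)) - gauss u.
    rewrite expr2 mulr_suml /gauss /quadratic_form !mulr_suml -sumrB.
    apply: eq_bigr => a _; rewrite mulr_sumr !mulr_suml -sumrB.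
    by apply: eq_bigr => b _; rewrite /bernstein_integrand; ring.
  by rewrite c0 expr0n mul0r sub0r opprK.
have int_bernstein a b := integrable_bernstein_integrand _ alpha_gt0 alpha_lt1 _
  (sqdist_ge0 (z a) (z b)).
have gauss_gt0 : (0 < \int[lebesgue_measure]_u (gauss u)%:E)%E.
  apply: lebesgue_integral_gt0 => //.
    rewrite (_ : gauss = fun u => - quadratic_form
      (fun a b => bernstein_integrand alpha (sqdist (z a) (z b)) u) c).
      apply: measurableT_comp => //.
      apply: measurable_sum => a; apply: measurable_sum => b.
      by apply: measurable_funM => //; exact: measurable_bernstein_integrand.
    by apply/funext => u; exact: gaussE.
  have [M [_ posM]] := quadratic_form_gaussian_gt0 z c a0 ma0.
  exists M; split=> [|u Mu]; first exact: num_real.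
  rewrite mulr_gt0 ?expR_gt0//; apply: posM.
  (* The threshold [M] concerns t = e^u, and e^u >= 1 + u > u carries it over to u. *)
  by apply: (lt_trans Mu); have := expR_ge1Dx u; lra.
move: gauss_gt0; under eq_integral do rewrite gaussE EFinN.
rewrite integralN/=; last first.
  by apply/integrable_add_def/(integrable_quadratic_form _ c int_bernstein).
rewrite (integral_quadratic_form _ c int_bernstein) oppe_gt0 lte_fin.
have -> : quadratic_form (fun a b => \int[lebesgue_measure]_t
    bernstein_integrand alpha (sqdist (z a) (z b)) t) c =
    form * bernstein_integral alpha.
  rewrite mulr_suml; apply: eq_bigr => a _; rewrite mulr_suml.
  apply: eq_bigr => b _.
  by rewrite /Rintegral integral_bernstein_integrand ?sqdist_ge0//= mulrA.
rewrite pmulr_llt0 //.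
(* It remains to see that the constant is positive; it is the integral at r = 1. *)
suff : (0 < \int[lebesgue_measure]_u (bernstein_integrand alpha 1 u)%:E)%E.
  by rewrite integral_bernstein_integrand// powR1 mul1r lte_fin.
apply: lebesgue_integral_gt0.
- exact: measurable_bernstein_integrand.
- by move=> u; exact: bernstein_integrand_ge0.
- by apply: nearW => u; exact: bernstein_integrand1_gt0.
Qed.

End strict_negative_type.

(** * Real and complex scalars as points of the plane *)

Section scalar_coordinates.
Context {R : realType} {k : scalar_kind}.

(** Placing the reals on the first axis lets one argument in the plane serve both scalar fields. *)
Definition scalar_coords : scalar_field R k -> R * R :=
  match k with
  | RealScalars => fun x : R => (x, 0)
  | ComplexScalars => @complex_coords R
  end.

Lemma scalar_coords_inj : injective scalar_coords.
Proof.
rewrite /scalar_coords; case: k => [x y [->]//|[a b] [a' b']].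
by rewrite /complex_coords => -[/= -> ->].
Qed.

Lemma measurable_scalar_coords : measurable_fun setT scalar_coords.
Proof.
rewrite /scalar_coords; case: k.
  exact: (measurable_fun_pair (@measurable_id _ R setT)).
by move=> _ Y mY; rewrite setTI; exists Y => //; rewrite setTI.
Qed.

Lemma modulusB_powR (u v : scalar_field R k) p :
  modulus (u - v) `^ p = sqdist (scalar_coords u) (scalar_coords v) `^ (p / 2).
Proof.
have -> : modulus (u - v) =
    Num.sqrt (sqdist (scalar_coords u) (scalar_coords v)).
  move: u v; rewrite /sqdist /scalar_coords; case: k => [x y|[a b] [a' b']]//=.
  by rewrite subrr expr0n addr0 sqrtr_sqr.
by rewrite -powR12_sqrt ?sqdist_ge0// -powRrM mulrC.
Qed.

Lemma modulus_powR (u : scalar_field R k) p :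
  modulus u `^ p = sqdist (scalar_coords u) (scalar_coords 0) `^ (p / 2).
Proof. by rewrite -modulusB_powR subr0. Qed.

End scalar_coordinates.

(** * Distances in L_p as integrals of pointwise distances *)

Section Lp_distance.
Context {R : realType} {d : measure_display} {Omega : measurableType d}.
Context {mu : {measure set Omega -> \bar R}} {p : R} {k : scalar_kind}.
Hypothesis p_gt0 : 0 < p.
Implicit Types f g : Lp mu p k.

Local Notation sqd f g w := (sqdist (scalar_coords (f w)) (scalar_coords (g w))).

Lemma measurable_Lp_sqdist_powR f g :
  measurable_fun setT (fun w => sqd f g w `^ (p / 2)).
Proof.
apply: (measurableT_comp (@measurable_powR R (p / 2))); apply: measurable_sqdist;
  by apply: (measurableT_comp measurable_scalar_coords); exact: measurable_funP.
Qed.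

Lemma eLp_norm_powR (h : Omega -> scalar_field R k) :
  (eLp_norm mu p h `^ p = \int[mu]_w (modulus (h w) `^ p)%:E)%E.
Proof.
rewrite /eLp_norm poweR_Lnorm ?gt_eqF//; apply: eq_integral => w _ /=.
(* The norm takes an absolute value of the modulus, which is already nonnegative. *)
congr (_ `^ _)%:E.
by apply: ger0_norm; case: (k) (h w) => [x|[x y]]; [exact: normr_ge0|exact: sqrtr_ge0].
Qed.

Lemma integrable_Lp_modulus_powR f :
  mu.-integrable setT (fun w => (modulus (f w) `^ p)%:E).
Proof.
apply/integrableP; split.
  apply/measurable_EFinP; under eq_fun do rewrite modulus_powR.
  apply: (measurableT_comp (@measurable_powR R (p / 2))); apply: measurable_sqdist => //.
  by apply: (measurableT_comp measurable_scalar_coords); exact: measurable_funP.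
under eq_integral do rewrite gee0_abs ?lee_fin ?powR_ge0//.
by rewrite -eLp_norm_powR; apply: poweR_lty; exact: (valP f).
Qed.

(** From |f - g|^2 <= 4 max(|f|^2, |g|^2), raising to the power p/2 gives |f - g|^p <= 4^(p/2)
    (|f|^p + |g|^p), a bound that covers p < 1 as well. *)
Lemma integrable_Lp_sqdist_powR f g :
  mu.-integrable setT (EFin \o (fun w => sqd f g w `^ (p / 2))).
Proof.
have p2_ge0 : 0 <= p / 2 by rewrite divr_ge0// ltW.
have sum_int := integrableD measurableT
  (integrable_Lp_modulus_powR f) (integrable_Lp_modulus_powR g).
apply: le_integrable (integrableZl measurableT (4 `^ (p / 2)) sum_int) => //.
  by apply/measurable_EFinP; exact: measurable_Lp_sqdist_powR.
move=> w _ /=; rewrite lee_fin.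
rewrite !ger0_norm ?mulr_ge0 ?addr_ge0 ?powR_ge0// !modulus_powR.
set Nf := sqdist _ (scalar_coords 0); set Ng := sqdist (_ (g w)) _.
have Nf0 : 0 <= Nf by exact: sqdist_ge0.
have Ng0 : 0 <= Ng by exact: sqdist_ge0.
have sqd_le : sqd f g w <= 4 * Num.max Nf Ng.
  have := sqdist_triangle (scalar_coords (f w))
    (scalar_coords (0 : scalar_field R k)) (scalar_coords (g w)).
  rewrite -/Nf [X in _ + X]sqdistC -/Ng.
  have : Nf <= Num.max Nf Ng by rewrite le_max lexx.
  have : Ng <= Num.max Nf Ng by rewrite le_max lexx orbT.
  by lra.
have max_ge0 : 0 <= Num.max Nf Ng by rewrite le_max Nf0.
apply: le_trans (ge0_ler_powR p2_ge0 _ _ sqd_le) _;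
  rewrite ?nnegrE ?sqdist_ge0 ?mulr_ge0//.
rewrite powRM// ler_wpM2l ?powR_ge0//.
by case: (leP Nf Ng) => _; rewrite ?lerDl ?lerDr powR_ge0.
Qed.

Lemma Lp_norm_sub_powR f g :
  Lp_norm mu p (f \- g) `^ p = \int[mu]_w (sqd f g w `^ (p / 2)).
Proof.
rewrite /Lp_norm -fine_poweR eLp_norm_powR /Rintegral; congr fine.
by apply: eq_integral => w _; rewrite modulusB_powR.
Qed.

End Lp_distance.

(** * Signed simplices as weighted families of total weight zero *)

Section simplex_form.
Context {R : realType} {s t : nat}.

Definition simplex_point {X : Type} (D : signed_simplex R X s t)
    (a : 'I_s + 'I_t) : X :=
  match a with inl j => xpt D j | inr i => ypt D i end.

Definition simplex_weight {X : Type} (D : signed_simplex R X s t)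
    (a : 'I_s + 'I_t) : R :=
  match a with inl j => xwt D j | inr i => - ywt D i end.

Lemma sum_simplex_weight {X : Type} (D : signed_simplex R X s t) :
  \sum_a simplex_weight D a = 0.
Proof. by rewrite big_sumType/= sumrN balanced subrr. Qed.

(** With the signs of [simplex_weight], the fiber mass at a point is [xmass] minus [ymass]. *)
Lemma degenerateP {X : eqType} (D : signed_simplex R X s t) :
  degenerate D <->
  forall a, fiber_mass (simplex_point D) (simplex_weight D) (simplex_point D a) = 0.
Proof.
have massE z : fiber_mass (simplex_point D) (simplex_weight D) z =
    xmass D z - ymass D z by rewrite /fiber_mass big_sumType/= sumrN.
split=> [degD a|mass0 z].
  rewrite massE degD ?subrr// mem_undup mem_cat.
  by case: a => [j|i] /=; rewrite codom_f ?orbT.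
rewrite mem_undup mem_cat => /orP[] /codomP[i ->].
  by apply/eqP; rewrite -subr_eq0 -massE; apply/eqP; exact: (mass0 (inl i)).
by apply/eqP; rewrite -subr_eq0 -massE; apply/eqP; exact: (mass0 (inr i)).
Qed.

(** The diagonal vanishes, and by symmetry the two triangles have equal sums. *)
Lemma sum_ltn_sym n (F : 'I_n -> 'I_n -> R) :
  (forall i j, F i j = F j i) -> (forall i, F i i = 0) ->
  \sum_i \sum_j F i j = 2 * \sum_(i < n) \sum_(j < n | (i < j)%N) F i j.
Proof.
move=> symF diagF.
have sum_gt : \sum_(i < n) \sum_(j < n | (j < i)%N) F i j =
    \sum_(i < n) \sum_(j < n | (i < j)%N) F i j.
  rewrite (exchange_big_dep predT)//=; apply: eq_bigr => i _.
  by apply: eq_bigr => j _; exact: symF.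
rewrite mulr_natl mulr2n -[X in _ = _ + X]sum_gt -big_split/=.
apply: eq_bigr => i _; rewrite (bigID (fun j : 'I_n => (i < j)%N))/=; congr (_ + _).
rewrite (bigID (fun j => j == i))/= (eq_bigl (pred1 i)) => [|j]; last first.
  by rewrite /= -leqNgt; case: eqVneq => [->|_]; rewrite ?leqnn ?andbF.
rewrite big_pred1_eq diagF add0r; apply: eq_bigl => j.
by rewrite -leqNgt andbC [(j < i)%N]ltn_neqAle.
Qed.

(** The two diagonal blocks give twice the triangular sums, and each of the two mixed blocks gives
    minus the cross sum. *)
Lemma simplex_quadratic_form {X : Type} (D : signed_simplex R X s t)
    (N : X -> X -> R) :
  (forall u v, N u v = N v u) -> (forall u, N u u = 0) ->
  quadratic_form (fun a b => N (simplex_point D a) (simplex_point D b))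
    (simplex_weight D) =
  2 * (\sum_(j1 < s) \sum_(j2 < s | (j1 < j2)%N)
         xwt D j1 * xwt D j2 * N (xpt D j1) (xpt D j2)
     + \sum_(i1 < t) \sum_(i2 < t | (i1 < i2)%N)
         ywt D i1 * ywt D i2 * N (ypt D i1) (ypt D i2)
     - \sum_(j < s) \sum_(i < t) xwt D j * ywt D i * N (xpt D j) (ypt D i)).
Proof.
move=> symN diagN; rewrite mulrBr mulrDr.
rewrite -(sum_ltn_sym _ (fun i j => xwt D i * xwt D j * N (xpt D i) (xpt D j))).
- rewrite -(sum_ltn_sym _ (fun i j => ywt D i * ywt D j * N (ypt D i) (ypt D j))).
  + rewrite /quadratic_form big_sumType/=.
    under eq_bigr do rewrite big_sumType/=.
    under [X in _ + X]eq_bigr do rewrite big_sumType/=.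
    rewrite !big_split/= [X in _ + (X + _)]exchange_big/=.
    set YY := \sum_i \sum_j ywt D i * ywt D j * _.
    set XY := \sum_j \sum_i xwt D j * ywt D i * _.
    have xyE : \sum_(j < s) \sum_(i < t)
        xwt D j * - ywt D i * N (xpt D j) (ypt D i) = - XY.
      rewrite -sumrN; apply: eq_bigr => j _; rewrite -sumrN.
      by apply: eq_bigr => i _; ring.
    have yxE : \sum_(j < s) \sum_(i < t)
        - ywt D i * xwt D j * N (ypt D i) (xpt D j) = - XY.
      rewrite -sumrN; apply: eq_bigr => j _; rewrite -sumrN.
      by apply: eq_bigr => i _; rewrite symN; ring.
    have yyE : \sum_(i1 < t) \sum_(i2 < t)
        - ywt D i1 * - ywt D i2 * N (ypt D i1) (ypt D i2) = YY.
      by apply: eq_bigr => i _; apply: eq_bigr => j _; rewrite mulrNN.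
    by rewrite xyE yxE yyE; ring.
  + by move=> i j; rewrite symN mulrAC; ring.
  + by move=> i; rewrite diagN mulr0.
- by move=> i j; rewrite symN; ring.
- by move=> i; rewrite diagN mulr0.
Qed.

End simplex_form.

(** * From the pointwise forms to the equality in L_p *)

Theorem theorem4p6 (R : realType) (k : scalar_kind) (d : measure_display)
    (Omega : measurableType d) (mu : {measure set Omega -> \bar R})
    (mu_nontrivial : mu [set: Omega] <> 0%E)
    (p : R) (p_gt0 : 0 < p) (p_lt2 : p < 2)
    (Lp_dim : at_least_two_dimensional mu p k)
    (s t : nat) (s_gt0 : (0 < s)%N) (t_gt0 : (0 < t)%N)
    (D : signed_simplex R (Lp mu p k) s t) (D_ndg : ~ degenerate D) :
  (\sum_(j1 < s) \sum_(j2 < s | (j1 < j2)%N)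
      xwt D j1 * xwt D j2 * Lp_norm mu p (xpt D j1 \- xpt D j2) `^ p
   + \sum_(i1 < t) \sum_(i2 < t | (i1 < i2)%N)
      ywt D i1 * ywt D i2 * Lp_norm mu p (ypt D i1 \- ypt D i2) `^ p
   = \sum_(j < s) \sum_(i < t)
      xwt D j * ywt D i * Lp_norm mu p (xpt D j \- ypt D i) `^ p)
  <-> virtually_degenerate D.
Proof.
(* The kernel is a power of the squared distance, so [p] is halved; p < 2 becomes alpha < 1. *)
pose alpha := p / 2.
have alpha_gt0 : 0 < alpha by rewrite divr_gt0.
have alpha_lt1 : alpha < 1 by rewrite ltr_pdivrMr// mul1r.
pose c := simplex_weight D.
pose z w a := scalar_coords (simplex_point D a w).
pose form w := quadratic_form (fun a b => sqdist (z w a) (z w b) `^ alpha) c.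
(* Fibers may be computed in the plane because [scalar_coords] is injective. *)
have degenerate_massE w : degenerate (map_simplex (Lp_eval w) D) <->
    forall a, fiber_mass (z w) c (z w a) = 0.
  have pointE : simplex_point (map_simplex (Lp_eval w) D) =1
      (fun a => simplex_point D a w) by case.
  have weightE : simplex_weight (map_simplex (Lp_eval w) D) =1 c by case.
  split=> [/degenerateP mass0 a|mass0]; last apply/degenerateP => a.
    rewrite -(mass0 a) /fiber_mass; apply: eq_big => [b|b _]; last by rewrite weightE.
    by rewrite !pointE (inj_eq scalar_coords_inj).
  rewrite -(mass0 a) /fiber_mass; apply: eq_big => [b|b _]; last by rewrite weightE.
  by rewrite !pointE (inj_eq scalar_coords_inj).
have form_eq0 w : form w = 0 <-> degenerate (map_simplex (Lp_eval w) D).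
  split=> [form0|/degenerate_massE]; last exact: sqdist_powR_form_eq0.
  apply/degenerate_massE => a; apply/eqP/negP => /negP ma.
  have := sqdist_powR_form_lt0 _ _ _ alpha_gt0 alpha_lt1 _ (sum_simplex_weight D) ma.
  by rewrite -/(form w) form0 ltxx.
have form_le0 w : form w <= 0.
  have [/degenerate_massE/form_eq0 ->//|] := pselect
    (forall a, fiber_mass (z w) c (z w a) = 0).
  move=> /existsNP[a /eqP ma]; apply/ltW.
  exact: sqdist_powR_form_lt0 alpha_gt0 alpha_lt1 _ (sum_simplex_weight D) ma.
pose K (a b : 'I_s + 'I_t) w := sqdist (z w a) (z w b) `^ alpha.
have intK a b : mu.-integrable setT (EFin \o K a b).
  exact: integrable_Lp_sqdist_powR.
pose N (f g : Lp mu p k) := Lp_norm mu p (f \- g) `^ p.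
have NE : (quadratic_form
    (fun a b => N (simplex_point D a) (simplex_point D b)) c)%:E =
    (\int[mu]_w (form w)%:E)%E.
  rewrite (integral_quadratic_form K c intK); congr EFin.
  apply: eq_bigr => a _; apply: eq_bigr => b _; congr (_ * _).
  by rewrite /N Lp_norm_sub_powR.
have N0 : quadratic_form
    (fun a b => N (simplex_point D a) (simplex_point D b)) c = 0 <->
    virtually_degenerate D.
  have mform : measurable_fun setT (EFin \o form).
    exact: measurable_int (integrable_quadratic_form K c intK).
  (* As [form] is nonpositive, its integral vanishes exactly when that of its absolute value does,
     that is, when it is zero almost everywhere. *)
  have absE : (\int[mu]_w `|(form w)%:E| = - \int[mu]_w (form w)%:E)%E.
    rewrite -integralN/=; last first.
      exact/integrable_add_def/(integrable_quadratic_form K c intK).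
    by apply: eq_integral => w _; rewrite /= ler0_norm.
  split=> [N0|[_ degD]].
    split=> //; have : (\int[mu]_w `|(form w)%:E| = 0)%E.
      by rewrite absE -NE N0 oppe0.
    move/(ae_eq_integral_abs mu measurableT mform); apply: filterS => w /(_ I) [].
    by move/form_eq0.
  apply: EFin_inj; rewrite NE; apply/eqP; rewrite -oppe_eq0 -absE; apply/eqP.
  apply/(ae_eq_integral_abs mu measurableT mform); apply: filterS degD => w.
  by move=> /form_eq0 formw _; rewrite /= formw.
(* The form is twice the difference of the two sides of the equality. *)
rewrite -N0 simplex_quadratic_form.
- split=> [->|/eqP]; first by rewrite subrr mulr0.
  by rewrite mulf_eq0 pnatr_eq0/= subr_eq0 => /eqP.
- move=> f g; rewrite /N !Lp_norm_sub_powR//.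
  by apply: eq_Rintegral => w _; rewrite sqdistC.
- move=> f; rewrite /N Lp_norm_sub_powR// /Rintegral integral0_eq//= => w _.
  by rewrite sqdistxx powR0// gt_eqF.
Qed.
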